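(* (Cohomological Shapiro lemma for partial actions) Let $\mathbb{K}$ be a field and let $W$ be a $\mathbb{K}_{par}G$-$\mathbb{K}H$-bimodule for some groups $G$ and $H$ such that $W$ is projective as a right $\mathbb{K}H$-module, $W$ is flat as a left $\mathbb{K}_{par}G$-module, and $B\otimes_{\mathbb{K}_{par}G}W$ is isomorphic to the trivial right $\mathbb{K}H$-module $\mathbb{K}$. Then for any right $\mathbb{K}H$-module $U$, considering $\mathrm{Hom}_{\mathbb{K}H}(W,U)$ as a right $\mathbb{K}_{par}G$-module, we have $$H^i_{par}(G,\mathrm{Hom}_{\mathbb{K}H}(W,U))\simeq H^i(H,U),\qquad i\ge0.$$
   Context: $\mathbb{K}_{par}G$ is the unital associative $\mathbb{K}$-algebra generated by symbols $[g]$, $g\in G$, subject to $[g][h][h^{-1}]=[gh][h^{-1}]$, $[g^{-1}][g][h]=[g^{-1}][gh]$ and $[1]=1$ for all $g,h\in G$. The elements $e_g=[g][g^{-1}]$ are pairwise commuting idempotents, and $B$ denotes the commutative subalgebra of $\mathbb{K}_{par}G$ generated by $\{e_g\mid g\in G\}$, viewed as a right $\mathbb{K}_{par}G$-module via $b^{[g]}=[g^{-1}]b[g]$. For a right $\mathbb{K}_{par}G$-module $M$, $H_{par}^n(G,M)=\mathrm{Ext}^n_{\mathbb{K}_{par}G}(B,M)$ (Ext of right modules). For a right $\mathbb{K}H$-module $U$, $H^i(H,U)=\mathrm{Ext}^i_{\mathbb{K}H}(\mathbb{K},U)$ with $\mathbb{K}$ the trivial right $\mathbb{K}H$-module. The right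 $\mathbb{K}_{par}G$-module structure on $\mathrm{Hom}_{\mathbb{K}H}(W,U)$ (homomorphisms of right $\mathbb{K}H$-modules) is $(fr)(w)=f(rw)$ for $r\in\mathbb{K}_{par}G$, $w\in W$. Isomorphisms of cohomology groups are of $\mathbb{K}$-vector spaces. *)

(* Defs.v *)
From HB Require Import structures.
From mathcomp Require Import all_boot all_algebra finmap.
From mathcomp.multinomials Require Import monalg.
From mathcomp Require Import boolp.

Set Implicit Arguments.
Unset Strict Implicit.
Unset Printing Implicit Defensive.

Import GRing.Theory.
Local Open Scope quotient_scope.
Local Open Scope ring_scope.

(* Right modules over a ring R are left modules over the converse ring, that
   is objects of lmodType R^c. *)
Notation rmodType R := (lmodType R^c).

Definition lmod_iso (R : pzRingType) (V W : lmodType R) : Prop :=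
  exists f : {linear V -> W}, bijective f.

Definition projective (R : pzRingType) (P : lmodType R) : Prop :=
  forall (M N : lmodType R) (p : {linear M -> N}) (f : {linear P -> N}),
    (forall y, exists x, p x = y) ->
    exists g : {linear P -> M}, forall x, p (g x) = f x.

(* {malg R[X]} is the free left R-module on X; mlift f is the linear extension
   of f : X -> V. *)
Section FreeModule.
Variables (R : nzRingType) (X : choiceType) (V : lmodType R).

Definition mlift (f : X -> V) (g : {malg R[X]}) : V :=
  \sum_(k <- msupp g) g@_k *: f k.

Lemma mliftEw (f : X -> V) (d : {fset X}) (g : {malg R[X]}) :
  (msupp g `<=` d)%fset -> mlift f g = \sum_(k <- d) g@_k *: f k.
Proof.
move=> le; rewrite /mlift (big_fset_incl _ le) //= => x xd /mcoeff_outdom ->.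
by rewrite scale0r.
Qed.

Fact mlift_is_linear f : linear (mlift f).
Proof.
move=> a g h /=.
have sub1 : (msupp g `<=` msupp g `|` msupp h)%fset by apply: fsubsetUl.
have sub2 : (msupp h `<=` msupp g `|` msupp h)%fset by apply: fsubsetUr.
have sub3 : (msupp (a *: g + h) `<=` msupp g `|` msupp h)%fset.
  apply: fsubset_trans (msuppD_le _ _) _; apply: fsetSU.
  exact: msuppZ_le.
rewrite (mliftEw f sub1) (mliftEw f sub2) (mliftEw f sub3).
rewrite scaler_sumr -big_split /=; apply: eq_bigr => k _.
by rewrite mcoeffD mcoeffZ scalerDl scalerA.
Qed.
HB.instance Definition _ f :=
  GRing.isLinear.Build R {malg R[X]} V *:%R (mlift f) (mlift_is_linear f).

Lemma mliftU f x : mlift f << x >> = f x.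
Proof. by rewrite (mliftEw f msuppU_le) big_seq_fset1 mcoeffUU scale1r. Qed.

Lemma malg_ind (P : {malg R[X]} -> Prop) :
  P 0 -> (forall x y, P x -> P y -> P (x + y)) ->
  (forall a k, P (a *: << k >>)) -> forall x, P x.
Proof.
move=> P0 PD PU x; rewrite [x]monalgE; elim/big_ind: _ => // k _.
suff -> : << x@_k *g k >> = x@_k *: << k >> by [].
by apply/malgP => j; rewrite mcoeffZ !mcoeffU mulrnAr mulr1.
Qed.

Lemma malg_linear_ext (f g : {linear {malg R[X]} -> V}) :
  (forall k, f << k >> = g << k >>) -> f =1 g.
Proof.
move=> fg; apply: malg_ind => [|x y hx hy|a k]; first by rewrite !linear0.
- by rewrite !linearD hx hy.
- by rewrite !linearZ_LR /= fg.
Qed.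

End FreeModule.

(* Unification would otherwise unfold finite-support sums; mliftU and linearity
   characterize mlift. *)
Global Opaque mlift.

Lemma free_projective (R : nzRingType) (X : choiceType) :
  projective {malg R[X]}.
Proof.
move=> M N p f psurj.
have [s sP] : {s : X -> M & forall x, p (s x) = f << x >>}.
  exists (fun x => projT1 (cid (psurj (f << x >>)))) => x.
  by case: cid.
exists (mlift s) => x.
pose h : {linear {malg R[X]} -> N} := GRing.Linear.clone _ _ _ _ (p \o mlift s) _.
by apply: (@malg_linear_ext R X N h f) => k; rewrite /h /= mliftU.
Qed.

(* The library's subspaces are finite-dimensional and its quotients are only
   Z-modules, hence the following. *)
Record submodule (R : pzRingType) (V : lmodType R) := Submodule {
  submod_mem :> V -> Prop;
  submod_mem0 : submod_mem 0;
  submod_memP : forall a x y,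
    submod_mem x -> submod_mem y -> submod_mem (a *: x + y)
}.

Section Submodule.
Variables (R : pzRingType) (V : lmodType R) (S : submodule V).

Definition submod_pred : {pred V} := fun x => `[< S x >].

Lemma submod_predE x : (x \in submod_pred) = `[< S x >]. Proof. by []. Qed.

Fact submod_pred_closed : submod_closed submod_pred.
Proof.
split=> [|a x y]; first exact/asboolP/submod_mem0.
by move=> /asboolP Sx /asboolP Sy; apply/asboolP/submod_memP.
Qed.

HB.instance Definition _ :=
  GRing.isSubmodClosed.Build R V submod_pred submod_pred_closed.

Record submod_type := SubmodElt {
  submod_val :> V;
  submod_valP : submod_val \in submod_pred
}.

HB.instance Definition _ := [isSub for submod_val].
HB.instance Definition _ := [Choice of submod_type by <:].
HB.instance Definition _ := [SubChoice_isSubLmodule of submod_type by <:].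

Definition submod_elt x (Sx : S x) : submod_type :=
  SubmodElt (introT (asboolP (S x)) Sx).

Lemma submod_typeP (x : submod_type) : S x.
Proof. exact/asboolP/submod_valP. Qed.

Definition submod_quot : Type := Quotient.quot submod_pred.
HB.instance Definition _ := Choice.on submod_quot.
HB.instance Definition _ := GRing.Zmodule.on submod_quot.

Definition submod_pi (x : V) : submod_quot := \pi_(Quotient.quot submod_pred) x.

Lemma submod_piP x y : submod_pi x = submod_pi y <-> S (x - y).
Proof.
rewrite /submod_pi; split=> [/eqP|Sxy].
  by rewrite -Quotient.idealrBE => /asboolP.
by apply/eqP; rewrite -Quotient.idealrBE; apply/asboolP.
Qed.

Lemma submod_piD x y : submod_pi (x + y) = submod_pi x + submod_pi y.
Proof. exact: raddfD. Qed.

Definition submod_rep (u : submod_quot) : V := repr u.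

Lemma submod_repK : cancel submod_rep submod_pi.
Proof. by move=> u; rewrite /submod_pi /submod_rep reprK. Qed.

Definition submod_scale (a : R) (u : submod_quot) : submod_quot :=
  submod_pi (a *: submod_rep u).

Lemma submod_scaleE a x : submod_scale a (submod_pi x) = submod_pi (a *: x).
Proof.
apply/submod_piP; rewrite -scalerBr -[_ *: _]addr0.
by apply: submod_memP; [apply/submod_piP; rewrite submod_repK|exact: submod_mem0].
Qed.

Fact submod_scaleA a b v :
  submod_scale a (submod_scale b v) = submod_scale (a * b) v.
Proof. by rewrite -[v]submod_repK !submod_scaleE scalerA. Qed.

Fact submod_scale1 : left_id 1 submod_scale.
Proof. by move=> v; rewrite -[v]submod_repK submod_scaleE scale1r. Qed.

Fact submod_scaleDr : right_distributive submod_scale +%R.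
Proof.
move=> a u v; rewrite -[u]submod_repK -[v]submod_repK.
by rewrite -submod_piD !submod_scaleE scalerDr submod_piD.
Qed.

Fact submod_scaleDl v : {morph submod_scale^~ v : a b / a + b}.
Proof.
move=> a b; rewrite -[v]submod_repK !submod_scaleE.
by rewrite scalerDl submod_piD.
Qed.

HB.instance Definition _ := GRing.Zmodule_isLmodule.Build R submod_quot
  submod_scaleA submod_scale1 submod_scaleDr submod_scaleDl.

Fact submod_pi_is_linear : linear submod_pi.
Proof. by move=> a x y; rewrite submod_piD -submod_scaleE. Qed.
HB.instance Definition _ :=
  GRing.isLinear.Build R V submod_quot *:%R submod_pi submod_pi_is_linear.

End Submodule.

Section Kernel.
Variables (R : pzRingType) (V W : lmodType R) (f : {linear V -> W}).

Fact ker_mem0 : f 0 = 0. Proof. exact: linear0. Qed.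
Fact ker_memP a x y : f x = 0 -> f y = 0 -> f (a *: x + y) = 0.
Proof. by move=> fx fy; rewrite linearP /= fx fy scaler0 addr0. Qed.

Definition ker_submod : submodule V :=
  @Submodule R V (fun x => f x = 0) ker_mem0 ker_memP.

End Kernel.

(* Hom_A(M, N) for right modules over a K-algebra A; K acts on it through the
   action of the central elements k%:A on N. *)
Section Hom.
Variables (K : fieldType) (A : algType K) (M N : rmodType A).

Definition homr : Type := {linear M -> N}.
Definition homr_fun (f : homr) : {linear M -> N} := f.
Coercion homr_fun : homr >-> GRing.Linear.type.

HB.instance Definition _ := gen_eqMixin homr.
HB.instance Definition _ := gen_choiceMixin homr.

Lemma homrP (f g : homr) : f =1 g <-> f = g.
Proof.
split=> [fg|-> //]; case: f g fg => [f cf] [g cg] /= fg.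
have {}fg : f = g := funext fg.
move: cf; rewrite {}fg; case: cg => [[d1] [d2]] [[c1] [c2]].
by rewrite (Prop_irrelevance c1 d1) (Prop_irrelevance c2 d2).
Qed.

Fact homr0_linear : linear (fun _ : M => 0 : N).
Proof. by move=> a x y; rewrite scaler0 addr0. Qed.
Fact homrN_linear (f : homr) : linear (fun x => - f x).
Proof. by move=> a x y; rewrite linearP /= opprD scalerN. Qed.
Fact homrD_linear (f g : homr) : linear (fun x => f x + g x).
Proof. by move=> a x y; rewrite !linearP /= scalerDr addrACA. Qed.
Fact homrZ_linear (k : K) (f : homr) :
  linear (fun x => (k%:A : A^c) *: f x).
Proof.
move=> a x y; rewrite linearP /= scalerDr !scalerA; congr (_ *: _ + _).
have central (c : A) : c * k%:A = k%:A * c.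
  by rewrite -scalerAr -scalerAl mulr1 mul1r.
exact: (central a).
Qed.

Definition homr0 : homr :=
  HB.pack_for {linear M -> N} (fun _ : M => 0 : N)
    (GRing.isLinear.Build A^c M N *:%R _ homr0_linear).
Definition homrN f : homr :=
  HB.pack_for {linear M -> N} (fun x => - homr_fun f x)
    (GRing.isLinear.Build A^c M N *:%R _ (homrN_linear f)).
Definition homrD f g : homr :=
  HB.pack_for {linear M -> N} (fun x => homr_fun f x + homr_fun g x)
    (GRing.isLinear.Build A^c M N *:%R _ (homrD_linear f g)).
Definition homrZ k f : homr :=
  HB.pack_for {linear M -> N} (fun x => (k%:A : A^c) *: homr_fun f x)
    (GRing.isLinear.Build A^c M N *:%R _ (homrZ_linear k f)).

Fact homrDA : associative homrD.
Proof. by move=> f g h; apply/homrP => x /=; rewrite addrA. Qed.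
Fact homrDC : commutative homrD.
Proof. by move=> f g; apply/homrP => x /=; rewrite addrC. Qed.
Fact homrD0 : left_id homr0 homrD.
Proof. by move=> f; apply/homrP => x /=; rewrite add0r. Qed.
Fact homrDN : left_inverse homr0 homrN homrD.
Proof. by move=> f; apply/homrP => x /=; rewrite addNr. Qed.

HB.instance Definition _ :=
  GRing.isZmodule.Build homr homrDA homrDC homrD0 homrDN.

Fact homrZA a b f : homrZ a (homrZ b f) = homrZ (a * b) f.
Proof.
apply/homrP => x /=; rewrite scalerA; congr (_ *: _).
have algM : b%:A * a%:A = (a * b)%:A :> A.
  by rewrite -scalerAl mul1r scalerA mulrC.
exact: algM.
Qed.
Fact homrZ1 : left_id 1 homrZ.
Proof. by move=> f; apply/homrP => x /=; rewrite scale1r (scale1r (_ x)). Qed.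
Fact homrZDr : right_distributive homrZ +%R.
Proof. by move=> a f g; apply/homrP => x /=; rewrite scalerDr. Qed.
Fact homrZDl f : {morph homrZ^~ f : a b / a + b}.
Proof.
move=> a b; apply/homrP => x /=; rewrite -scalerDl; congr (_ *: _).
exact: scalerDl.
Qed.

HB.instance Definition _ :=
  GRing.Zmodule_isLmodule.Build K homr homrZA homrZ1 homrZDr homrZDl.

End Hom.

(* Ext^n_A(N, M) is the cohomology of Hom_A(P, M), where
     ... -> P_2 -> P_1 -> P_0 -> N -> 0
   is a projective resolution of N. *)
Section ExtDef.
Variables (K : fieldType) (A : algType K).

Record proj_resolution (N : rmodType A) := ProjResolution {
  res_obj : nat -> rmodType A;
  res_d : forall n, {linear res_obj n.+1 -> res_obj n};
  res_aug : {linear res_obj 0 -> N};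
  res_proj : forall n, projective (res_obj n);
  res_aug_surj : forall y, exists x, res_aug x = y;
  res_exact0 : forall x, res_aug x = 0 <-> exists y, res_d 0 y = x;
  res_exactS : forall n x, res_d n x = 0 <-> exists y, res_d n.+1 y = x
}.

Section Cohomology.
Variables (N : rmodType A) (P : proj_resolution N) (M : rmodType A).

Definition cocycle n (f : homr (res_obj P n) M) : Prop :=
  forall x, f (res_d P n x) = 0.

Fact cocycle0 n : @cocycle n 0. Proof. by []. Qed.
Fact cocycleP n a (f g : homr (res_obj P n) M) :
  cocycle f -> cocycle g -> cocycle (a *: f + g).
Proof. by move=> fc gc x /=; rewrite fc gc scaler0 addr0. Qed.

Definition cocycles n : submodule (homr (res_obj P n) M) :=
  Submodule (@cocycle0 n) (@cocycleP n).

Definition coboundary n : homr (res_obj P n) M -> Prop :=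
  match n with
  | 0 => fun f => f = 0
  | m.+1 => fun f => exists h : homr (res_obj P m) M, forall x, f x = h (res_d P m x)
  end.

Fact coboundary0 n : @coboundary n 0.
Proof. by case: n => [//|m]; exists 0. Qed.
Fact coboundaryP n a (f g : homr (res_obj P n) M) :
  coboundary f -> coboundary g -> coboundary (a *: f + g).
Proof.
case: n f g => [|m] f g; first by move=> -> ->; rewrite scaler0 addr0.
by move=> [h hE] [l lE]; exists (a *: h + l) => x /=; rewrite hE lE.
Qed.

Definition coboundaries n : submodule (submod_type (cocycles n)) :=
  @Submodule K (submod_type (cocycles n))
    (fun f => coboundary (submod_val f)) (@coboundary0 n)
    (fun a f g => @coboundaryP n a (submod_val f) (submod_val g)).

Definition cohomology n : lmodType K := submod_quot (coboundaries n).

End Cohomology.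

(* The standard free resolution: P_n is free on the underlying set of the n-th
   syzygy module. *)
Section StandardResolution.

Definition free_cover (N : rmodType A) : rmodType A := {malg A^c[N]}.

Definition free_aug (N : rmodType A) : {linear free_cover N -> N} :=
  mlift (id : N -> N).

Definition syz (N : rmodType A) : rmodType A :=
  submod_type (ker_submod (free_aug N)).

Definition syz_incl (N : rmodType A) : {linear syz N -> free_cover N} :=
  (\val : submod_type (ker_submod (free_aug N)) -> free_cover N).

Lemma free_aug_surj N y : exists x, free_aug N x = y.
Proof. by exists << y >>; rewrite /free_aug /= mliftU. Qed.

Lemma free_aug_exact N (x : free_cover N) :
  free_aug N x = 0 <-> exists y, syz_incl N y = x.
Proof.
split=> [x0|[y <-]]; last exact: (submod_typeP y).
by exists (@submod_elt _ _ (ker_submod (free_aug N)) x x0).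
Qed.

Variable N : rmodType A.

Definition syzygy n : rmodType A := iter n syz N.

Definition std_obj n : rmodType A := free_cover (syzygy n).

Definition std_d n : {linear std_obj n.+1 -> std_obj n} :=
  GRing.Linear.clone _ _ _ _ (syz_incl (syzygy n) \o free_aug (syzygy n.+1)) _.

Lemma std_exact n (x : std_obj n) :
  free_aug (syzygy n) x = 0 <-> exists y, std_d n y = x.
Proof.
split=> [/free_aug_exact[y <-]|[y <-]].
  by have [z <-] := free_aug_surj (y : syzygy n.+1); exists z.
by apply/free_aug_exact; exists (free_aug (syzygy n.+1) y).
Qed.

Lemma std_exactS n (x : std_obj n.+1) :
  std_d n x = 0 <-> exists y, std_d n.+1 y = x.
Proof.
rewrite -std_exact; split=> [x0|x0]; first exact: val_inj.
by rewrite [LHS]/= x0.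
Qed.

Definition std_resolution : proj_resolution N :=
  @ProjResolution N std_obj std_d (free_aug N)
    (fun n => @free_projective A^c (syzygy n)) (@free_aug_surj N)
    (@std_exact 0) std_exactS.

End StandardResolution.

Definition Ext (n : nat) (N M : rmodType A) : lmodType K :=
  cohomology (std_resolution N) M n.

End ExtDef.

(* An A-B-bimodule is a right B-module with a commuting left action of A; as A
   and B are K-algebras, K is required to act in the same way on both sides. *)
HB.mixin Record Rmodule_isBimodule (K : fieldType) (A B : algType K) W
    of GRing.Lmodule B^c W := {
  lact : A -> W -> W;
  lactA : forall a b w, lact a (lact b w) = lact (a * b) w;
  lact1 : forall w, lact 1 w = w;
  lactDr : forall a v w, lact a (v + w) = lact a v + lact a w;
  lactDl : forall a b w, lact (a + b) w = lact a w + lact b w;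
  lact_scale : forall a (b : B^c) w, lact a (b *: w) = b *: lact a w;
  lact_alg : forall (k : K) w, lact k%:A w = (k%:A : B^c) *: w
}.

#[short(type="bimodType")]
HB.structure Definition Bimodule (K : fieldType) (A B : algType K) :=
  {W of Rmodule_isBimodule K A B W & GRing.Lmodule B^c W}.

Section LeftModule.
Variables (K : fieldType) (A B : algType K) (W : bimodType A B).

Definition left_mod : Type := W.
HB.instance Definition _ := GRing.Zmodule.on left_mod.

Fact left_modA a b (w : left_mod) :
  lact a (lact b w : W) = lact (a * b) (w : W) :> left_mod.
Proof. exact: lactA. Qed.
Fact left_mod1 : left_id (1 : A) (fun a (w : left_mod) => lact a (w : W) : left_mod).
Proof. exact: lact1. Qed.
Fact left_modDr :
  right_distributive (fun (a : A) (w : left_mod) => lact a (w : W) : left_mod) +%R.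
Proof. exact: lactDr. Qed.
Fact left_modDl (w : left_mod) :
  {morph (fun a : A => lact a (w : W) : left_mod) : a b / a + b}.
Proof. by move=> a b; exact: lactDl. Qed.

HB.instance Definition _ := GRing.Zmodule_isLmodule.Build A left_mod
  left_modA left_mod1 left_modDr left_modDl.

Fact rmul_linear (b : B^c) :
  linear (fun w : left_mod => (b *: (w : W)) : left_mod).
Proof. by move=> a v w; rewrite scalerDr -lact_scale. Qed.

Definition rmul (b : B^c) : {linear left_mod -> left_mod} :=
  HB.pack_for {linear left_mod -> left_mod} 
    (fun w : left_mod => (b *: (w : W)) : left_mod)
    (GRing.isLinear.Build A left_mod left_mod *:%R _ (rmul_linear b)).

End LeftModule.

(* Hom_B(W, U) as a right A-module, with (f r)(w) = f(r w). *)
Section HomRight.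
Variables (K : fieldType) (A B : algType K) (W : bimodType A B) (U : rmodType B).

Definition rhom : Type := homr W U.
HB.instance Definition _ := GRing.Zmodule.on rhom.

Fact rhom_act_linear (r : A) (f : homr W U) : linear (fun w : W => f (lact r w)).
Proof. by move=> b v w; rewrite lactDr lact_scale linearP. Qed.

Definition rhom_act (r : A^c) (f : rhom) : rhom :=
  HB.pack_for {linear W -> U} (fun w : W => homr_fun f (lact (r : A) w))
    (GRing.isLinear.Build B^c W U *:%R _ (rhom_act_linear r f)).

Fact rhom_actA a b f : rhom_act a (rhom_act b f) = rhom_act (a * b) f.
Proof. by apply/homrP => w /=; rewrite lactA. Qed.
Fact rhom_act1 : left_id 1 rhom_act.
Proof. by move=> f; apply/homrP => w /=; rewrite lact1. Qed.
Fact rhom_actDr : right_distributive rhom_act +%R.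
Proof. by move=> a f g; apply/homrP. Qed.
Fact rhom_actDl f : {morph rhom_act^~ f : a b / a + b}.
Proof. by move=> a b; apply/homrP => w /=; rewrite lactDl linearD. Qed.

HB.instance Definition _ := GRing.Zmodule_isLmodule.Build A^c rhom
  rhom_actA rhom_act1 rhom_actDr rhom_actDl.

End HomRight.

(* M ⊗_A N for a right A-module M and a left A-module N: the free abelian group
   on M * N modulo biadditivity and balancedness. *)
Section Tensor.
Variables (R : nzRingType) (M : rmodType R) (N : lmodType R).

Inductive tensor_rel : {malg int[(M * N)%type]} -> Prop :=
| tensor_rel0 : tensor_rel 0
| tensor_relP a x y : tensor_rel x -> tensor_rel y -> tensor_rel (a *: x + y)
| tensor_relDl m m' n :
    tensor_rel (<< (m + m', n) >> - << (m, n) >> - << (m', n) >>)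
| tensor_relDr m n n' :
    tensor_rel (<< (m, n + n') >> - << (m, n) >> - << (m, n') >>)
| tensor_relZ m (a : R) n :
    tensor_rel (<< ((a : R^c) *: m, n) >> - << (m, a *: n) >>).

Definition tensor_relators : submodule {malg int[(M * N)%type]} :=
  Submodule tensor_rel0 tensor_relP.

Definition tensor : Type := submod_quot tensor_relators.
HB.instance Definition _ := GRing.Zmodule.on tensor.

Definition tens (m : M) (n : N) : tensor := submod_pi tensor_relators << (m, n) >>.

Lemma tensDl m m' n : tens (m + m') n = tens m n + tens m' n.
Proof.
rewrite /tens -submod_piD; apply/submod_piP.
by rewrite opprD addrA; exact: tensor_relDl.
Qed.

Lemma tensDr m n n' : tens m (n + n') = tens m n + tens m n'.
Proof.
rewrite /tens -submod_piD; apply/submod_piP.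
by rewrite opprD addrA; exact: tensor_relDr.
Qed.

Lemma tensZ m (a : R) n : tens ((a : R^c) *: m) n = tens m (a *: n).
Proof. by apply/submod_piP; exact: tensor_relZ. Qed.

Fact tens_is_nmod n : nmod_morphism (tens^~ n).
Proof.
split=> [|m m']; last exact: tensDl.
by apply: (addrI (tens 0 n)); rewrite -tensDl !addr0.
Qed.

Lemma tensor_ind (P : tensor -> Prop) :
  (forall m n, P (tens m n)) -> (forall x y, P x -> P y -> P (x + y)) ->
  forall x, P x.
Proof.
move=> Pt PD u; rewrite -[u](@submod_repK int).
elim/malg_ind: (submod_rep u) => [|x y Px Py|a [m n]].
- by rewrite linear0 -[0](tens_is_nmod 0).1; exact: Pt.
- by rewrite submod_piD; exact: PD.
- rewrite -[a]intz scaler_int raddfMz /=.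
  pose f : {additive M -> tensor} := HB.pack_for {additive M -> tensor}
    (tens^~ n) (GRing.isNmodMorphism.Build M tensor _ (tens_is_nmod n)).
  by have <- := raddfMz f a m; exact: Pt.
Qed.

End Tensor.

Section TensorMap.
Variables (R : nzRingType) (M M' : rmodType R) (N N' : lmodType R).
Variables (f : {linear M -> M'}) (g : {linear N -> N'}).

Definition tensor_lift : {linear {malg int[(M * N)%type]} -> tensor M' N'} :=
  mlift (fun p : M * N => tens (f p.1) (g p.2)).

Definition tensor_map (u : tensor M N) : tensor M' N' :=
  tensor_lift (submod_rep u).

Let liftE m n : tensor_lift << (m, n) >> = tens (f m) (g n).
Proof. exact: mliftU. Qed.

Fact tensor_map_rel x : tensor_rel x -> tensor_lift x = 0.
Proof.
elim=> [|a y z _ y0 _ z0|m m' n|m n n'|m a n].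
- exact: linear0.
- by rewrite linearP y0 z0 scaler0 addr0.
- by rewrite !linearB !liftE linearD tensDl addrAC addrK subrr.
- by rewrite !linearB !liftE linearD tensDr addrAC addrK subrr.
- by rewrite !linearB !liftE !linearZ_LR tensZ subrr.
Qed.

Lemma tensor_map_pi x :
  tensor_map (submod_pi (tensor_relators M N) x) = tensor_lift x.
Proof.
apply/eqP; rewrite -subr_eq0 /tensor_map -linearB; apply/eqP.
apply: tensor_map_rel; apply: (proj1 (submod_piP (tensor_relators M N) _ _)).
by rewrite submod_repK.
Qed.

Lemma tensor_mapE m n : tensor_map (tens m n) = tens (f m) (g n).
Proof. by rewrite tensor_map_pi liftE. Qed.

Fact tensor_map_is_nmod : nmod_morphism tensor_map.
Proof.
have mapD u v : tensor_map (u + v) = tensor_map u + tensor_map v.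
  rewrite -[u](@submod_repK int) -[v](@submod_repK int) -submod_piD.
  by rewrite !tensor_map_pi; exact: linearD.
by split=> //; apply: (addrI (tensor_map 0)); rewrite -mapD !addr0.
Qed.
HB.instance Definition _ :=
  Algebra.isNmodMorphism.Build (tensor M N) (tensor M' N') tensor_map
    tensor_map_is_nmod.

End TensorMap.

(* Characterized by additivity and tensor_mapE. *)
Global Opaque tensor_map.

Definition flat (R : nzRingType) (N : lmodType R) : Prop :=
  forall (M M' : rmodType R) (f : {linear M -> M'}),
    injective f -> injective (tensor_map f (idfun : {linear N -> N})).

(* M ⊗_A W as a right B-module, with (m ⊗ w) b = m ⊗ (w b). *)
Section TensorRight.
Variables (K : fieldType) (A B : algType K) (M : rmodType A) (W : bimodType A B).

Definition rtensor_act (b : B^c) (u : tensor M (left_mod W)) :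
    tensor M (left_mod W) :=
  tensor_map (idfun : {linear M -> M}) (rmul W b) u.

Lemma rtensor_actE b m (w : W) :
  rtensor_act b (tens m (w : left_mod W)) = tens m (b *: w : left_mod W).
Proof. exact: tensor_mapE. Qed.

Fact rtensor_actDr : right_distributive rtensor_act +%R.
Proof. by move=> b u v; exact: raddfD. Qed.

Fact rtensor_actA a b u : rtensor_act a (rtensor_act b u) = rtensor_act (a * b) u.
Proof.
elim/tensor_ind: u => [m w|u v hu hv].
- by rewrite [rtensor_act b _]rtensor_actE [LHS]rtensor_actE scalerA -rtensor_actE.
- apply: etrans (congr1 (rtensor_act a) (rtensor_actDr b u v)) _.
  apply: etrans (rtensor_actDr a _ _) _.
  exact: etrans (congr2 +%R hu hv) (esym (rtensor_actDr _ _ _)).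
Qed.
Fact rtensor_act1 : left_id 1 rtensor_act.
Proof.
elim/tensor_ind => [m w|u v hu hv].
- by rewrite [LHS]rtensor_actE scale1r.
- by rewrite [LHS]rtensor_actDr hu hv.
Qed.
Fact rtensor_actDl u : {morph rtensor_act^~ u : a b / a + b}.
Proof.
move=> a b; elim/tensor_ind: u => [m w|u v hu hv].
- by rewrite [LHS]rtensor_actE scalerDl [LHS]tensDr -!rtensor_actE.
- rewrite (rtensor_actDr _ u v) hu hv addrACA.
  exact: esym (congr2 +%R (rtensor_actDr a u v) (rtensor_actDr b u v)).
Qed.

HB.instance Definition _ :=
  GRing.Zmodule_isLmodule.Build B^c (tensor M (left_mod W))
    rtensor_actA rtensor_act1 rtensor_actDr rtensor_actDl.

End TensorRight.

(* The trivial right K[H]-module; every h in H acts as the identity, see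
   triv_actE. *)
Definition triv_mod (K : fieldType) (H : groupType) : Type := K.

(* The group algebra K[H]: finitely supported functions on H with convolution.
   The type {malg K[H]} has a library ring structure only over monoids without
   nontrivial units, so the product is defined here on an alias. *)
Section GroupAlgebra.
Variables (K : fieldType) (H : groupType).

Local Notation triv_mod := (triv_mod K H).

Definition group_alg : Type := {malg K[H]}.
HB.instance Definition _ := GRing.Lmodule.on group_alg.

Definition galg_of (h : H) : group_alg := << h >>.

Definition galg_mul (x y : group_alg) : group_alg :=
  mlift (fun g => mlift (fun h => galg_of (g * h)%g) y) x.

Lemma galg_ind (P : group_alg -> Prop) :
  P 0 -> (forall x y, P x -> P y -> P (x + y)) ->
  (forall (a : K) h, P (a *: galg_of h)) -> forall x, P x.
Proof. exact: malg_ind. Qed.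

Fact galg_mulDl : left_distributive galg_mul +%R.
Proof. by move=> x y z; exact: linearD. Qed.

Fact galg_mulZl a x y : a *: galg_mul x y = galg_mul (a *: x) y.
Proof. exact: esym (linearZ _ _). Qed.

Fact galg_mul0l y : galg_mul 0 y = 0.
Proof. exact: linear0. Qed.

Fact galg_mulUl g y : galg_mul (galg_of g) y = mlift (fun h => galg_of (g * h)%g) y.
Proof. exact: mliftU. Qed.

Fact galg_mulUU g h : galg_mul (galg_of g) (galg_of h) = galg_of (g * h)%g.
Proof. by rewrite galg_mulUl; exact: mliftU. Qed.

Local Opaque galg_mul galg_of.

Fact galg_mulDr : right_distributive galg_mul +%R.
Proof.
move=> x y z; elim/galg_ind: x => [|x1 x2 h1 h2|a h].
- by rewrite !galg_mul0l addr0.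
- rewrite !galg_mulDl h1 h2; exact: addrACA.
- rewrite -!galg_mulZl !galg_mulUl -scalerDr; congr (_ *: _).
  exact: linearD.
Qed.

Fact galg_mulZr a x y : a *: galg_mul x y = galg_mul x (a *: y).
Proof.
elim/galg_ind: x => [|x1 x2 h1 h2|b h].
- by rewrite !galg_mul0l scaler0.
- by rewrite !galg_mulDl scalerDr h1 h2.
- rewrite -!galg_mulZl !galg_mulUl scalerA mulrC -scalerA; congr (_ *: _).
  exact: esym (linearZ _ _).
Qed.

Fact galg_mul0r x : galg_mul x 0 = 0.
Proof. by have := galg_mulZr 0 x 0; rewrite !scale0r. Qed.

Fact galg_mulA : associative galg_mul.
Proof.
move=> x y z; elim/galg_ind: x => [|x1 x2 h1 h2|a g].
- by rewrite !galg_mul0l.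
- by rewrite !galg_mulDl h1 h2.
rewrite -!galg_mulZl; congr (_ *: _).
elim/galg_ind: y => [|y1 y2 h1 h2|b h].
- by rewrite galg_mul0r !galg_mul0l galg_mul0r.
- by rewrite galg_mulDr !galg_mulDl galg_mulDr h1 h2.
rewrite -!galg_mulZr -!galg_mulZl -galg_mulZr; congr (_ *: _).
elim/galg_ind: z => [|z1 z2 h1 h2|c k].
- by rewrite !galg_mul0r.
- by rewrite !galg_mulDr h1 h2.
by rewrite -!galg_mulZr !galg_mulUU mulgA.
Qed.

Fact galg_mul1 : left_id (galg_of 1%g) galg_mul.
Proof.
elim/galg_ind => [|x y hx hy|a h]; first exact: galg_mul0r.
- by rewrite galg_mulDr hx hy.
- by rewrite -galg_mulZr galg_mulUU mul1g.
Qed.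

Fact galg_mulr1 : right_id (galg_of 1%g) galg_mul.
Proof.
elim/galg_ind => [|x y hx hy|a h]; first exact: galg_mul0l.
- by rewrite galg_mulDl hx hy.
- by rewrite -galg_mulZl galg_mulUU mulg1.
Qed.

Fact galg_1neq0 : galg_of 1%g != 0.
Proof.
apply/eqP => /(congr1 (mcoeff (1%g : H))) /eqP.
by rewrite mcoeffUU mcoeff0 oner_eq0.
Qed.

HB.instance Definition _ := GRing.Zmodule_isNzRing.Build group_alg
  galg_mulA galg_mul1 galg_mulr1 galg_mulDl galg_mulDr galg_1neq0.
HB.instance Definition _ := GRing.Lmodule_isLalgebra.Build K group_alg galg_mulZl.
HB.instance Definition _ := GRing.Lalgebra_isAlgebra.Build K group_alg galg_mulZr.

(* x |-> the sum of the coefficients of x. *)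
Definition galg_aug : {linear {malg K[H]} -> K^o} := mlift (fun _ => 1).

Local Transparent galg_of.

Lemma galg_augU h : galg_aug (galg_of h) = 1.
Proof. exact: (mliftU (fun _ : H => 1 : K^o) h). Qed.

Fact galg_augD (x y : group_alg) : galg_aug (x + y) = galg_aug x + galg_aug y.
Proof. exact: (linearD galg_aug). Qed.

Fact galg_augZ a (x : group_alg) : galg_aug (a *: x) = a * galg_aug x.
Proof. exact: (linearZ_LR galg_aug a x). Qed.

Fact galg_aug0 : galg_aug 0 = 0. Proof. exact: (linear0 galg_aug). Qed.

Fact galg_augM (x y : group_alg) : galg_aug (x * y) = galg_aug x * galg_aug y.
Proof.
elim/galg_ind: x => [|x1 x2 h1 h2|a g]; first by rewrite mul0r galg_aug0 mul0r.
- by rewrite mulrDl !galg_augD h1 h2 mulrDl.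
rewrite -scalerAl !galg_augZ -mulrA; congr (_ * _).
elim/galg_ind: y => [|y1 y2 h1 h2|b h]; first by rewrite mulr0 galg_aug0 mulr0.
- by rewrite mulrDr !galg_augD h1 h2 mulrDr.
rewrite -scalerAr !galg_augZ mulrCA; congr (_ * _).
by rewrite [X in galg_aug X]galg_mulUU !galg_augU mulr1.
Qed.

HB.instance Definition _ := GRing.Zmodule.on triv_mod.

Definition triv_act (x : group_alg^c) (a : triv_mod) : triv_mod :=
  (a : K) * galg_aug x.

Fact triv_actA x y a : triv_act x (triv_act y a) = triv_act (x * y) a.
Proof. by rewrite /triv_act -mulrA -galg_augM. Qed.
Fact triv_act1 : left_id 1 triv_act.
Proof. by move=> a; rewrite /triv_act [galg_aug _]galg_augU mulr1. Qed.
Fact triv_actDr : right_distributive triv_act +%R.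
Proof. by move=> x a b; exact: mulrDl. Qed.
Fact triv_actDl a : {morph triv_act^~ a : x y / x + y}.
Proof. by move=> x y; rewrite /triv_act galg_augD; exact: mulrDr. Qed.

HB.instance Definition _ := GRing.Zmodule_isLmodule.Build group_alg^c triv_mod
  triv_actA triv_act1 triv_actDr triv_actDl.

Lemma triv_actE h (a : triv_mod) : (galg_of h : group_alg^c) *: a = a.
Proof.
change (triv_act (galg_of h) a = a).
by rewrite /triv_act galg_augU; exact: mulr1.
Qed.

End GroupAlgebra.

(* The partial group algebra: the free algebra {malg K[{fmonom G}]} on symbols
   [g], g in G, modulo the two-sided ideal generated by the relators. *)
Section PartialGroupAlgebra.
Variables (K : fieldType) (G : groupType).

Local Notation F := {malg K[{fmonom G}]}.

Definition fsym (g : G) : F := << fmu g >>.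

Inductive par_ideal : F -> Prop :=
| par_ideal0 : par_ideal 0
| par_idealB x y : par_ideal x -> par_ideal y -> par_ideal (x - y)
| par_idealMl a x : par_ideal x -> par_ideal (a * x)
| par_idealMr a x : par_ideal x -> par_ideal (x * a)
| par_rel_right g h :
    par_ideal (fsym g * fsym h * fsym h^-1%g - fsym (g * h)%g * fsym h^-1%g)
| par_rel_left g h :
    par_ideal (fsym g^-1%g * fsym g * fsym h - fsym g^-1%g * fsym (g * h)%g)
| par_rel1 : par_ideal (fsym 1%g - 1).

Definition par_pred : {pred F} := fun x => `[< par_ideal x >].

Fact par_pred_closed : zmod_closed par_pred.
Proof.
split=> [|x y]; first exact/asboolP/par_ideal0.
by move=> /asboolP hx /asboolP hy; apply/asboolP/par_idealB.
Qed.
HB.instance Definition _ := GRing.isZmodClosed.Build F par_pred par_pred_closed.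

Definition par_alg : Type := Quotient.quot par_pred.
HB.instance Definition _ := Choice.on par_alg.
HB.instance Definition _ := GRing.Zmodule.on par_alg.

Definition par_pi (x : F) : par_alg := \pi_(Quotient.quot par_pred) x.
Definition par_rep (u : par_alg) : F := repr u.

Lemma par_repK : cancel par_rep par_pi.
Proof. by move=> u; rewrite /par_pi /par_rep reprK. Qed.

Lemma par_piP x y : par_pi x = par_pi y <-> par_ideal (x - y).
Proof.
rewrite /par_pi; split=> [/eqP|Sxy].
  by rewrite -Quotient.idealrBE => /asboolP.
by apply/eqP; rewrite -Quotient.idealrBE; apply/asboolP.
Qed.

Lemma par_piD x y : par_pi (x + y) = par_pi x + par_pi y.
Proof. exact: raddfD. Qed.

Definition par_mul (u v : par_alg) : par_alg := par_pi (par_rep u * par_rep v).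
Definition par_scale (a : K) (u : par_alg) : par_alg := par_pi (a *: par_rep u).

Fact par_mulE x y : par_mul (par_pi x) (par_pi y) = par_pi (x * y).
Proof.
have rep_ideal z : par_ideal (par_rep (par_pi z) - z).
  by apply/par_piP; rewrite par_repK.
apply/par_piP; set x' := par_rep _; set y' := par_rep _.
have -> : x' * y' - x * y = x' * (y' - y) - (- (x' - x) * y).
  by rewrite mulrBr mulNr opprK mulrBl addrA subrK.
rewrite mulNr opprK -[X in par_ideal (_ + X)]opprK -mulNr.
apply: par_idealB; first exact/par_idealMl/rep_ideal.
apply: par_idealMr; rewrite -sub0r; apply: par_idealB (rep_ideal x).
exact: par_ideal0.
Qed.

Fact par_scaleE a x : par_scale a (par_pi x) = par_pi (a *: x).
Proof.
apply/par_piP; rewrite -scalerBr -[X in _ *: X]mul1r scalerAl.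
by apply: par_idealMl; apply/par_piP; rewrite par_repK.
Qed.

Fact par_mulA : associative par_mul.
Proof.
move=> u v w; rewrite -[u]par_repK -[v]par_repK -[w]par_repK.
by rewrite !par_mulE mulrA.
Qed.
Fact par_mul1 : left_id (par_pi 1) par_mul.
Proof. by move=> u; rewrite -[u]par_repK par_mulE mul1r. Qed.
Fact par_mulr1 : right_id (par_pi 1) par_mul.
Proof. by move=> u; rewrite -[u]par_repK par_mulE mulr1. Qed.
Fact par_mulDl : left_distributive par_mul +%R.
Proof.
move=> u v w; rewrite -[u]par_repK -[v]par_repK -[w]par_repK.
by rewrite -par_piD !par_mulE mulrDl par_piD.
Qed.
Fact par_mulDr : right_distributive par_mul +%R.
Proof.
move=> w u v; rewrite -[u]par_repK -[v]par_repK -[w]par_repK.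
by rewrite -par_piD !par_mulE mulrDr par_piD.
Qed.

(* The algebra is nonzero: [g] |-> 1 kills the ideal but not 1. *)
Let one_mor : {fmonom G} -> K := fun _ => 1.
Fact one_mor_mmorphism : mmorphism one_mor.
Proof. by split=> // x y; rewrite /one_mor mulr1. Qed.
HB.instance Definition _ :=
  isMultiplicative.Build {fmonom G} K one_mor one_mor_mmorphism.

Let eps : {rmorphism F -> K} := mmap (idfun : {rmorphism K -> K}) one_mor.
Let epsU g : eps (fsym g) = 1. Proof. by rewrite /eps /= mmapU mulr1. Qed.

Fact par_1neq0 : par_pi 1 != 0.
Proof.
have eM x y : eps x = 1 -> eps y = 1 -> eps (x * y) = 1.
  by move=> x1 y1; rewrite (rmorphM eps) x1 y1 mulr1.
have eB x y : eps x = 1 -> eps y = 1 -> eps (x - y) = 0.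
  by move=> x1 y1; rewrite (rmorphB eps) x1 y1 subrr.
have eps0 x : par_ideal x -> eps x = 0.
  elim=> [|y z _ y0 _ z0|a y _ y0|a y _ y0|g h|g h|].
  - exact: rmorph0.
  - by rewrite (rmorphB eps) y0 z0 subr0.
  - by rewrite (rmorphM eps) y0 mulr0.
  - by rewrite (rmorphM eps) y0 mul0r.
  - exact: (eB _ _ (eM _ _ (eM _ _ (epsU _) (epsU _)) (epsU _))
                   (eM _ _ (epsU _) (epsU _))).
  - exact: (eB _ _ (eM _ _ (eM _ _ (epsU _) (epsU _)) (epsU _))
                   (eM _ _ (epsU _) (epsU _))).
  - exact: (eB _ _ (epsU _) (rmorph1 eps)).
have pi0 : par_pi 0 = 0 by exact: raddf0.
apply/eqP; rewrite -pi0 => /par_piP; rewrite subr0 => /eps0 /eqP.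
by rewrite (rmorph1 eps) oner_eq0.
Qed.

HB.instance Definition _ := GRing.Zmodule_isNzRing.Build par_alg
  par_mulA par_mul1 par_mulr1 par_mulDl par_mulDr par_1neq0.

Fact par_scaleA a b v : par_scale a (par_scale b v) = par_scale (a * b) v.
Proof. by rewrite -[v]par_repK !par_scaleE scalerA. Qed.
Fact par_scale1 : left_id 1 par_scale.
Proof. by move=> v; rewrite -[v]par_repK par_scaleE scale1r. Qed.
Fact par_scaleDr : right_distributive par_scale +%R.
Proof.
move=> a u v; rewrite -[u]par_repK -[v]par_repK.
by rewrite -par_piD !par_scaleE scalerDr par_piD.
Qed.
Fact par_scaleDl v : {morph par_scale^~ v : a b / a + b}.
Proof.
by move=> a b; rewrite -[v]par_repK !par_scaleE scalerDl par_piD.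
Qed.
HB.instance Definition _ := GRing.Zmodule_isLmodule.Build K par_alg
  par_scaleA par_scale1 par_scaleDr par_scaleDl.

Lemma par_piM x y : par_pi (x * y) = par_pi x * par_pi y.
Proof. exact: esym (par_mulE x y). Qed.
Lemma par_piZ a x : par_pi (a *: x) = a *: par_pi x.
Proof. exact: esym (par_scaleE a x). Qed.

Fact par_scaleAl a (u v : par_alg) : a *: (u * v) = a *: u * v.
Proof.
by rewrite -[u]par_repK -[v]par_repK -par_piM -!par_piZ -par_piM scalerAl.
Qed.
HB.instance Definition _ := GRing.Lmodule_isLalgebra.Build K par_alg par_scaleAl.

Fact free_mulC (a : K) (x : F) : x * a%:MP = a%:MP * x.
Proof.
rewrite mul_malgC malgM_def malgZ_def fgmulgU; apply: eq_bigr => k _.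
by rewrite mulm1 mulrC.
Qed.

Fact free_scaleAr a (x y : F) : a *: (x * y) = x * (a *: y).
Proof. by rewrite -!mul_malgC !mulrA free_mulC. Qed.

Fact par_scaleAr a (u v : par_alg) : a *: (u * v) = u * (a *: v).
Proof.
rewrite -[u]par_repK -[v]par_repK -par_piM -!par_piZ -par_piM.
by rewrite free_scaleAr.
Qed.
HB.instance Definition _ := GRing.Lalgebra_isAlgebra.Build K par_alg par_scaleAr.

Definition psym (g : G) : par_alg := par_pi (fsym g).

Lemma psym_right g h :
  psym g * psym h * psym h^-1%g = psym (g * h)%g * psym h^-1%g.
Proof. by rewrite /psym -!par_piM; apply/par_piP/par_rel_right. Qed.

Lemma psym_left g h :
  psym g^-1%g * psym g * psym h = psym g^-1%g * psym (g * h)%g.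
Proof. by rewrite /psym -!par_piM; apply/par_piP/par_rel_left. Qed.

Lemma psym1 : psym 1%g = 1.
Proof. exact/par_piP/par_rel1. Qed.

End PartialGroupAlgebra.

(* For s : G -> P satisfying the defining relations, the idempotents
   e_g = s g * s g^-1, the subalgebra they generate, and the conjugations
   b |-> s g^-1 * b * s g. *)
Section PartialRepresentation.
Variables (K : fieldType) (G : groupType) (P : algType K) (s : G -> P).

Local Notation F := {malg K[{fmonom G}]}.

Definition pidem (g : G) : P := s g * s g^-1%g.
Local Notation e := pidem.

Inductive par_B_mem : P -> Prop :=
| par_B1 : par_B_mem 1
| par_Be g : par_B_mem (e g)
| par_BD x y : par_B_mem x -> par_B_mem y -> par_B_mem (x + y)
| par_BZ (a : K) x : par_B_mem x -> par_B_mem (a *: x)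
| par_BM x y : par_B_mem x -> par_B_mem y -> par_B_mem (x * y).

Fact par_B_mem0 : par_B_mem 0.
Proof. rewrite -(scale0r (1 : P)); exact/par_BZ/par_B1. Qed.
Fact par_B_memP a x y : par_B_mem x -> par_B_mem y -> par_B_mem (a *: x + y).
Proof. by move=> hx hy; apply: par_BD => //; apply: par_BZ. Qed.

Definition par_B_submod : submodule P := Submodule par_B_mem0 par_B_memP.

Hypothesis s_right : forall g h, s g * s h * s h^-1%g = s (g * h)%g * s h^-1%g.
Hypothesis s_left : forall g h, s g^-1%g * s g * s h = s g^-1%g * s (g * h)%g.
Hypothesis s1 : s 1%g = 1.

Lemma psymK g : s g * s g^-1%g * s g = s g.
Proof.
by have := s_left g^-1%g g; rewrite !invgK mulVg s1 mulr1.
Qed.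

Lemma psym_idem g h : s g * e h = e (g * h)%g * s g.
Proof.
rewrite /pidem mulrA s_right.
have := s_left (g * h)^-1%g g; rewrite !invgK => ->.
by rewrite invgM mulgVK.
Qed.

Lemma pidem_comm g h : e g * e h = e h * e g.
Proof.
rewrite {1}/pidem -mulrA psym_idem mulrA psym_idem mulVKg -mulrA.
by [].
Qed.

Lemma par_B_comm g x : par_B_mem x -> x * e g = e g * x.
Proof.
elim=> [|h|y z _ hy _ hz|a y _ hy|y z _ hy _ hz].
- by rewrite mul1r mulr1.
- exact: pidem_comm.
- by rewrite mulrDl mulrDr hy hz.
- by rewrite -scalerAl -scalerAr hy.
- by rewrite -mulrA hz mulrA hy mulrA.
Qed.

Definition pconj (g : G) (b : P) : P := s g^-1%g * b * s g.

Fact pconj_linear g : linear (pconj g).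
Proof. by move=> a x y; rewrite /pconj mulrDr mulrDl -scalerAr -scalerAl. Qed.
HB.instance Definition _ g :=
  GRing.isLinear.Build K P P *:%R (pconj g) (pconj_linear g).

Fact pconj_right g h b :
  pconj h^-1%g (pconj h (pconj g b)) = pconj h^-1%g (pconj (g * h)%g b).
Proof.
have l := s_left h^-1%g g^-1%g; have r := s_right g h.
by rewrite /pconj !mulrA l -(mulrA _ (s g)) -(mulrA _ (s g * s h)) r invgM !mulrA.
Qed.

Fact pconj_left g h b :
  pconj h (pconj g (pconj g^-1%g b)) = pconj (g * h)%g (pconj g^-1%g b).
Proof.
have l := s_left g h; have r := s_right h^-1%g g^-1%g.
rewrite !invgK in r *.
by rewrite /pconj !mulrA invgK r -(mulrA _ (s g^-1%g)) -(mulrA _ (s g^-1%g * s g)) l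
  invgM !mulrA.
Qed.

Fact pconj1 b : pconj 1%g b = b.
Proof. by rewrite /pconj invg1 s1 mul1r mulr1. Qed.

Fact pconj_mem g x : par_B_mem x -> par_B_mem (pconj g x).
Proof.
have pconjM y z : par_B_mem y -> pconj g (y * z) = pconj g y * pconj g z.
  move=> hy; rewrite /pconj.
  have -> : s g^-1%g * y * s g * (s g^-1%g * z * s g) =
            s g^-1%g * (y * e g) * z * s g by rewrite /pidem !mulrA.
  rewrite par_B_comm // /pidem !mulrA.
  by have := psymK g^-1%g; rewrite invgK => ->.
elim=> [|h|y z _ hy _ hz|a y _ hy|y z hy0 hy _ hz].
- by have := par_Be g^-1%g; rewrite /pidem /pconj invgK mulr1.
- rewrite /pconj psym_idem -mulrA; apply: par_BM; first exact: par_Be.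
  by have := par_Be g^-1%g; rewrite /pidem invgK.
- by rewrite linearD; apply: par_BD.
- by rewrite linearZ; apply: par_BZ.
- by rewrite pconjM //; apply: par_BM.
Qed.

Definition pconjs (w : {fmonom G}) (b : P) : P :=
  foldl (fun c g => pconj g c) b w.

Fact pconjs_linear w : linear (pconjs w).
Proof.
rewrite /pconjs => a x y; elim: (w : seq G) x y => [|g t IH] x y //=.
by rewrite linearP IH.
Qed.
HB.instance Definition _ w :=
  GRing.isLinear.Build K P P *:%R (pconjs w) (pconjs_linear w).

Definition pconjf (b : P) : {linear F -> P} := mlift (fun w => pconjs w b).

Fact pconjfU w b : pconjf b << w >> = pconjs w b.
Proof. exact: mliftU. Qed.

Fact pconjf1 b : pconjf b 1 = b.
Proof. by rewrite [LHS]pconjfU /pconjs fm1. Qed.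

Fact pconjf_sym g b : pconjf b (fsym K g) = pconj g b.
Proof. by rewrite pconjfU /pconjs fmU. Qed.

Fact pconjf_linear x a b c : pconjf (a *: b + c) x = a *: pconjf b x + pconjf c x.
Proof.
elim/malg_ind: x => [|y z hy hz|k w].
- by rewrite !linear0 ?scaler0 addr0.
- rewrite !(linearD (pconjf _)) hy hz scalerDr.
  exact: addrACA.
- rewrite !(linearZ_LR (pconjf _)) !pconjfU.
  by rewrite linearP scalerDr !scalerA mulrC.
Qed.

Fact pconjf0 x : pconjf 0 x = 0.
Proof.
by apply: (addrI (pconjf 0 x)); rewrite -[X in X + _]scale1r -pconjf_linear scale1r !addr0.
Qed.

Fact pconjfDb x b c : pconjf (b + c) x = pconjf b x + pconjf c x.
Proof. by rewrite -[b in LHS]scale1r pconjf_linear scale1r. Qed.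

Fact pconjfZb x a b : pconjf (a *: b) x = a *: pconjf b x.
Proof. by rewrite -[a *: b]addr0 pconjf_linear pconjf0 addr0. Qed.

Fact pconjfM x y b : pconjf b (x * y) = pconjf (pconjf b x) y.
Proof.
elim/malg_ind: x => [|x1 x2 h1 h2|k w].
- by rewrite mul0r (linear0 (pconjf b)) pconjf0.
- apply: etrans (congr1 (pconjf b) (mulrDl x1 x2 y)) _.
  apply: etrans (linearD (pconjf b) _ _) _.
  apply: etrans (congr2 +%R h1 h2) _; apply: etrans (esym (pconjfDb _ _ _)) _.
  by rewrite (linearD (pconjf b) x1 x2).
apply: etrans (congr1 (pconjf b) (esym (scalerAl k _ y))) _.
apply: etrans (linearZ_LR (pconjf b) _ _) _; apply: esym.
rewrite (linearZ_LR (pconjf b) k << w >>).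
apply: etrans (pconjfZb _ _ _) _; apply: congr1; apply: esym.
elim/malg_ind: y => [|x1 x2 h1 h2|l v].
- by rewrite mulr0 (linear0 (pconjf b)) (linear0 (pconjf _)).
- apply: etrans (congr1 (pconjf b) (mulrDr _ x1 x2)) _.
  apply: etrans (linearD (pconjf b) _ _) _; apply: etrans (congr2 +%R h1 h2) _.
  exact: esym (linearD (pconjf _) _ _).
apply: etrans (congr1 (pconjf b) (esym (free_scaleAr l _ _))) _.
apply: etrans (linearZ_LR (pconjf b) _ _) _; apply: esym.
apply: etrans (linearZ_LR (pconjf _) _ _) _; apply: congr1; apply: esym.
have -> : << w >> * << v >> = << mmul w v >> :> F.
  by have := fgmulUU (1 : K) 1 w v; rewrite mulr1.
by rewrite !pconjfU /pconjs fmM foldl_cat.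
Qed.

Fact pconjf_ideal x b : par_ideal x -> pconjf b x = 0.
Proof.
have eqB x1 x2 c : pconjf c x1 = pconjf c x2 -> pconjf c (x1 - x2) = 0.
  by move=> x12; rewrite (linearB (pconjf c)) x12 subrr.
have mul3 x1 x2 x3 c :
    pconjf c (x1 * x2 * x3) = pconjf (pconjf (pconjf c x1) x2) x3.
  apply: etrans (pconjfM _ _ _) _.
  by rewrite (pconjfM x1 x2 c).
move=> Ix; elim: Ix b => [|y z _ hy _ hz|a y _ hy|a y _ hy|g h|g h|] b.
- exact: (linear0 (pconjf b)).
- by rewrite (linearB (pconjf b)) hy hz subr0.
- by rewrite pconjfM hy.
- by rewrite pconjfM hy pconjf0.
- apply: eqB; apply: etrans (mul3 _ _ _ _) (etrans _ (esym (pconjfM _ _ _))).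
  rewrite (pconjf_sym g b) (pconjf_sym h (pconj g b)) (pconjf_sym (g * h)%g b).
  by rewrite (pconjf_sym h^-1%g (pconj h _)) pconjf_sym; exact: pconj_right.
- apply: eqB; apply: etrans (mul3 _ _ _ _) (etrans _ (esym (pconjfM _ _ _))).
  by rewrite !pconjf_sym; exact: pconj_left.
- by apply: eqB; rewrite pconjf_sym pconj1 pconjf1.
Qed.

Fact pconjf_mem x b : par_B_mem b -> par_B_mem (pconjf b x).
Proof.
move=> hb; elim/malg_ind: x => [|y z hy hz|k w].
- by rewrite (linear0 (pconjf b)); exact: par_B_mem0.
- by rewrite (linearD (pconjf b)); apply: par_BD.
rewrite (linearZ_LR (pconjf b)) pconjfU; apply: par_BZ.
rewrite /pconjs; elim: (w : seq G) b hb => [|g t IH] c hc //=.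
exact/IH/pconj_mem.
Qed.

End PartialRepresentation.

(* B as a right module over the partial group algebra; the action extends
   b^[g] = [g^-1] b [g], see par_B_sym. *)
Section BModule.
Variables (K : fieldType) (G : groupType).

Local Notation P := (par_alg K G).
Local Notation par_B_mem := (par_B_mem (@psym K G)).
Local Notation pconjf := (pconjf (@psym K G)).

Definition par_B : Type := submod_type (par_B_submod (@psym K G)).
HB.instance Definition _ := GRing.Zmodule.on par_B.

Fact par_B_pconjf x b : par_B_mem b -> par_B_mem (pconjf b x).
Proof. exact: (pconjf_mem (@psym_right K G) (@psym_left K G) (@psym1 K G)). Qed.

Fact par_B_ideal x b : par_ideal x -> pconjf b x = 0.
Proof. exact: (pconjf_ideal (@psym_right K G) (@psym_left K G) (@psym1 K G)). Qed.

Definition par_B_act (r : P^c) (b : par_B) : par_B :=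
  @submod_elt _ _ (par_B_submod (@psym K G)) _
    (@par_B_pconjf (par_rep (r : P)) (submod_val b) (submod_typeP b)).

Fact par_B_actE x (b : par_B) :
  submod_val (par_B_act (par_pi x) b) = pconjf (submod_val b) x.
Proof.
apply/eqP; rewrite -subr_eq0 -(linearB (pconjf _)); apply/eqP/par_B_ideal.
by apply/par_piP; rewrite par_repK.
Qed.

Fact par_B_actA r s b : par_B_act r (par_B_act s b) = par_B_act (r * s) b.
Proof.
apply: val_inj; rewrite -[r]par_repK -[s]par_repK.
have -> : (par_pi (par_rep (r : P)) : P^c) * par_pi (par_rep (s : P)) =
          par_pi (par_rep (s : P) * par_rep (r : P)) by rewrite par_piM.
by rewrite [RHS]par_B_actE [LHS]par_B_actE par_B_actE pconjfM.
Qed.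
Fact par_B_act1 : left_id 1 par_B_act.
Proof.
move=> b; apply: val_inj; rewrite [LHS](par_B_actE 1 b).
exact: pconjf1.
Qed.
Fact par_B_actDr : right_distributive par_B_act +%R.
Proof.
by move=> r b c; apply: val_inj; exact: pconjfDb.
Qed.
Fact par_B_actDl b : {morph par_B_act^~ b : r s / r + s}.
Proof.
move=> r s; apply: val_inj; rewrite -[r]par_repK -[s]par_repK -par_piD.
apply: etrans (par_B_actE _ _) _; apply: etrans (linearD (pconjf _) _ _) _.
exact: esym (f_equal2 (fun x y : P => x + y) (par_B_actE (par_rep (r : P)) b)
  (par_B_actE (par_rep (s : P)) b)).
Qed.

HB.instance Definition _ := GRing.Zmodule_isLmodule.Build P^c par_B
  par_B_actA par_B_act1 par_B_actDr par_B_actDl.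

Lemma par_B_sym g (b : par_B) :
  submod_val ((psym K g : P^c) *: b) =
    psym K g^-1%g * submod_val b * psym K g.
Proof. by rewrite [LHS]par_B_actE pconjf_sym. Qed.

End BModule.

Section Cohomologies.
Variables (K : fieldType) (G H : groupType).

Definition Hpar (n : nat) (M : rmodType (par_alg K G)) : lmodType K :=
  Ext n (par_B K G) M.

Definition Hgroup (n : nat) (U : rmodType (group_alg K H)) : lmodType K :=
  Ext n (triv_mod K H) U.

End Cohomologies.

Definition tensor_rmod (K : fieldType) (A B : algType K) (M : rmodType A)
    (W : bimodType A B) : rmodType B :=
  tensor M (left_mod W).

Definition hom_rmod (K : fieldType) (A B : algType K) (W : bimodType A B)
    (U : rmodType B) : rmodType A :=
  rhom W U.

(* Main.v *)
Require Import Defs.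
From HB Require Import structures.
From mathcomp Require Import all_boot all_algebra.
From mathcomp.multinomials Require Import monalg.
From mathcomp Require Import boolp.

(** Write A for the partial group algebra of G and B for the group algebra of
    H. The functor - (x)_A W from right A-modules to right B-modules is left
    adjoint to Hom_B(W, -), and it carries a projective resolution P of an
    A-module N to a projective resolution of N (x)_A W:

    - it preserves projectivity, because its right adjoint Hom_B(W, -) preserves
      surjections when W is projective over B [tensorW_projective];
    - it preserves exactness, because W is flat over A [tensorW_exact].

    The adjunction is natural, so it identifies, degree by degree, the cochain
    complex Hom_A(P, Hom_B(W, U)) with Hom_B(P (x)_A W, U); hence the two have
    the same cohomology [cohomology_tensor_hom_iso]. For N the algebra generated
    by the idempotents [g][g^-1], N (x)_A W is isomorphic to the trivial module,
    so that P (x)_A W is, up to this isomorphism, one of its projective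
    resolutions, and the second complex computes the group cohomology of H with
    coefficients in U by the comparison theorem: projective resolutions of
    isomorphic modules give the same cohomology [cohomology_resolution_iso]. *)

Set Implicit Arguments.
Unset Strict Implicit.
Unset Printing Implicit Defensive.

Import GRing.Theory.
Local Open Scope ring_scope.

(** * Submodules and quotients *)

Definition linear_of (R : pzRingType) (V W : lmodType R) (f : V -> W)
    (f_linear : linear f) : {linear V -> W} :=
  HB.pack_for {linear V -> W} f (GRing.isLinear.Build R V W *:%R f f_linear).

Section Submodules.
Variables (R : pzRingType) (V W : lmodType R).

Lemma submod_pi_eq0 (S : submodule V) x : submod_pi S x = 0 <-> S x.
Proof.
rewrite -[0](linear0 (submod_pi S)) -[in X in _ <-> X](subr0 x).
exact: submod_piP.
Qed.

Lemma submod_quot_factor (S : submodule V) (f : {linear V -> W}) :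
  (forall x, S x -> f x = 0) ->
  exists g : {linear submod_quot S -> W}, forall x, g (submod_pi S x) = f x.
Proof.
move=> f0; pose g (u : submod_quot S) := f (submod_rep u).
have gE x : g (submod_pi S x) = f x.
  apply/eqP; rewrite -subr_eq0 -linearB; apply/eqP/f0/submod_piP.
  by rewrite submod_repK.
have g_linear : linear g.
  move=> a u v; rewrite -[u]submod_repK -[v]submod_repK.
  by rewrite -linearP !gE linearP.
by exists (linear_of g_linear) => x; exact: gE.
Qed.

Fact image_mem0 (f : {linear V -> W}) : exists x, f x = 0.
Proof. by exists 0; rewrite linear0. Qed.
Fact image_memP (f : {linear V -> W}) a y z :
  (exists x, f x = y) -> (exists x, f x = z) -> exists x, f x = a *: y + z.
Proof. by move=> [u <-] [v <-]; exists (a *: u + v); rewrite linearP. Qed.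

Definition image_submod (f : {linear V -> W}) : submodule W :=
  @Submodule R W (fun y => exists x, f x = y) (image_mem0 f) (@image_memP f).

Lemma submod_corestrict (S : submodule W) (f : {linear V -> W}) :
  (forall x, S (f x)) ->
  exists g : {linear V -> submod_type S}, forall x, submod_val (g x) = f x.
Proof.
move=> Sf; pose g x := submod_elt (Sf x).
have g_linear : linear g.
  move=> a x y; apply: val_inj; exact: linearP.
by exists (linear_of g_linear).
Qed.

End Submodules.

(** * Comparison of projective resolutions *)

(** A form of projectivity for exact sequences: p need only be surjective onto
    the range of f, as one can replace N by the image of p. *)
Lemma projective_lift (R : pzRingType) (P M N : lmodType R)
    (p : {linear M -> N}) (f : {linear P -> N}) :
  projective P -> (forall x, exists y, p y = f x) ->
  exists g : {linear P -> M}, forall x, p (g x) = f x.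
Proof.
move=> projP im_f.
have [p' p'E] : exists p' : {linear M -> submod_type (image_submod p)},
    forall x, submod_val (p' x) = p x.
  by apply: submod_corestrict => x; exists x.
have [f' f'E] : exists f' : {linear P -> submod_type (image_submod p)},
    forall x, submod_val (f' x) = f x.
  exact: submod_corestrict.
have p'_surj y : exists x, p' x = y.
  have [x xy] := submod_typeP y; exists x; apply: val_inj.
  exact: etrans (p'E x) xy.
have [g gE] := projP _ _ p' f' p'_surj.
by exists g => x; rewrite -p'E gE f'E.
Qed.

Section Comparison.
Variables (K : fieldType) (A : algType K) (N N' : rmodType A).
Variables (P : proj_resolution N) (Q : proj_resolution N').

Definition graded_map := forall n, {linear res_obj P n -> res_obj Q n}.

Definition chain_map (f : graded_map) :=
  forall n x, res_d Q n (f n.+1 x) = f n (res_d P n x).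

Lemma res_dd n x : res_d P n (res_d P n.+1 x) = 0.
Proof. by apply/res_exactS; exists x. Qed.

Lemma res_aug_d x : res_aug P (res_d P 0 x) = 0.
Proof. by apply/res_exact0; exists x. Qed.

(** Each component is a lift of the previous one along the differential of Q,
    which exists because P is projective and Q is exact. *)
Lemma chain_map_lift (a : {linear N -> N'}) :
  exists f : graded_map,
    chain_map f /\ forall x, res_aug Q (f 0 x) = a (res_aug P x).
Proof.
have [f0 f0E] : exists f0 : {linear res_obj P 0 -> res_obj Q 0},
    forall x, res_aug Q (f0 x) = (a \o res_aug P) x.
  by apply: projective_lift; [exact: res_proj|move=> x; exact: res_aug_surj].
(* The recursion carries two consecutive components, since the next lift
   depends on their commuting with the differentials. *)
pose square n := {ff : {linear res_obj P n -> res_obj Q n} *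
    {linear res_obj P n.+1 -> res_obj Q n.+1} |
  forall x, res_d Q n (ff.2 x) = ff.1 (res_d P n x)}.
have start : {s : square 0 | (sval s).1 = f0}.
  have /cid [f1 f1E] : exists f1 : {linear res_obj P 1 -> res_obj Q 1},
      forall x, res_d Q 0 (f1 x) = (f0 \o res_d P 0) x.
    apply: projective_lift; first exact: res_proj.
    by move=> x; apply/res_exact0; rewrite f0E /= res_aug_d linear0.
  by exists (exist _ (f0, f1) f1E).
have next n (s : square n) : {t : square n.+1 | (sval t).1 = (sval s).2}.
  case: s => -[f g] /= fg.
  have /cid [h hE] : exists h : {linear res_obj P n.+2 -> res_obj Q n.+2},
      forall x, res_d Q n.+1 (h x) = (g \o res_d P n.+1) x.
    apply: projective_lift; first exact: res_proj.
    by move=> x; apply/res_exactS; rewrite fg res_dd linear0.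
  by exists (exist _ (g, h) hE).
pose s := fix s n : square n :=
  if n is m.+1 then sval (next m (s m)) else sval start.
exists (fun n => (sval (s n)).1); split=> [n x|x] /=.
  by rewrite (svalP (next n (s n))) (svalP (s n)).
by rewrite (svalP start) f0E.
Qed.

(** Exactness of Q makes it possible to lift, degree by degree, the part of f
    that the homotopy built so far does not account for. *)
Lemma chain_map_null_homotopic (f : graded_map) :
  chain_map f -> (forall x, res_aug Q (f 0 x) = 0) ->
  exists h : forall n, {linear res_obj P n -> res_obj Q n.+1},
    (forall x, f 0 x = res_d Q 0 (h 0 x)) /\
    (forall n x, f n.+1 x = res_d Q n.+1 (h n.+1 x) + h n (res_d P n x)).
Proof.
move=> fd f0.
(* The side condition on h says that f n.+1 - h d has values in the kernel of
   the differential, hence can be lifted to the next component. *)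
pose htpy n := {h : {linear res_obj P n -> res_obj Q n.+1} |
  forall x, res_d Q n (f n.+1 x) = res_d Q n (h (res_d P n x))}.
have start : {s : htpy 0 | forall x, res_d Q 0 (sval s x) = f 0 x}.
  have /cid [h hE] : exists h : {linear res_obj P 0 -> res_obj Q 1},
      forall x, res_d Q 0 (h x) = f 0 x.
    apply: projective_lift; first exact: res_proj.
    by move=> x; apply/res_exact0.
  have hd x : res_d Q 0 (f 1 x) = res_d Q 0 (h (res_d P 0 x)).
    by rewrite hE fd.
  by exists (exist _ h hd).
have next n (s : htpy n) : {t : htpy n.+1 |
    forall x, res_d Q n.+1 (sval t x) = f n.+1 x - sval s (res_d P n x)}.
  case: s => h /= hd.
  have r_linear : linear (fun x => f n.+1 x - h (res_d P n x)).
    by move=> k x y; rewrite !linearP /= scalerDr addrACA.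
  have /cid [l lE] : exists l : {linear res_obj P n.+1 -> res_obj Q n.+2},
      forall x, res_d Q n.+1 (l x) = linear_of r_linear x.
    apply: projective_lift; first exact: res_proj.
    by move=> x; apply/res_exactS; rewrite /= linearB hd subrr.
  have ld x : res_d Q n.+1 (f n.+2 x) = res_d Q n.+1 (l (res_d P n.+1 x)).
    by rewrite lE /= fd res_dd linear0 subr0.
  by exists (exist _ l ld).
pose s := fix s n : htpy n :=
  if n is m.+1 then sval (next m (s m)) else sval start.
exists (fun n => sval (s n)); split=> [x|n x].
  by rewrite /= (svalP start).
by rewrite [X in X + _](svalP (next n (s n))) subrK.
Qed.

End Comparison.

(** * Isomorphisms of cohomology *)

Lemma submod_quot_iso (R : pzRingType) (V W : lmodType R) (S : submodule V)
    (T : submodule W) (f : {linear V -> W}) (g : {linear W -> V}) :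
    (forall x, S x -> T (f x)) -> (forall y, T y -> S (g y)) ->
    (forall x, S (g (f x) - x)) -> (forall y, T (f (g y) - y)) ->
  lmod_iso (submod_quot S) (submod_quot T).
Proof.
move=> fS gT gf fg.
have [f' f'E] : exists f' : {linear submod_quot S -> submod_quot T},
    forall x, f' (submod_pi S x) = (submod_pi T \o f) x.
  apply: submod_quot_factor => x Sx; exact/submod_pi_eq0/fS.
have [g' g'E] : exists g' : {linear submod_quot T -> submod_quot S},
    forall y, g' (submod_pi T y) = (submod_pi S \o g) y.
  apply: submod_quot_factor => y Ty; exact/submod_pi_eq0/gT.
exists f'; exists g' => [u|u]; rewrite -[u]submod_repK.
  by rewrite f'E g'E; apply/submod_piP; exact: gf.
by rewrite g'E f'E; apply/submod_piP; exact: fg.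
Qed.

(** The two complexes may be over different algebras: this criterion serves both
    for the comparison of resolutions and for the adjunction. Only degree n is
    involved, so that a homotopy appears through its effect on cocycles. *)
Lemma cohomology_iso (K : fieldType) (A A' : algType K) (N : rmodType A)
    (N' : rmodType A') (P : proj_resolution N) (P' : proj_resolution N')
    (M : rmodType A) (M' : rmodType A') n
    (F : {linear homr (res_obj P n) M -> homr (res_obj P' n) M'})
    (G : {linear homr (res_obj P' n) M' -> homr (res_obj P n) M}) :
    (forall c, cocycle c -> cocycle (F c)) ->
    (forall c, cocycle c -> cocycle (G c)) ->
    (forall c, coboundary c -> coboundary (F c)) ->
    (forall c, coboundary c -> coboundary (G c)) ->
    (forall c, cocycle c -> coboundary (G (F c) - c)) ->
    (forall c, cocycle c -> coboundary (F (G c) - c)) ->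
  lmod_iso (cohomology P M n) (cohomology P' M' n).
Proof.
move=> Fz Gz Fb Gb GF FG.
have [f fE] : exists f : {linear submod_type (cocycles P M n) ->
      submod_type (cocycles P' M' n)},
    forall c, submod_val (f c) = (F \o \val) c.
  by apply: submod_corestrict => c; apply: Fz; exact: (submod_typeP c).
have [g gE] : exists g : {linear submod_type (cocycles P' M' n) ->
      submod_type (cocycles P M n)},
    forall c, submod_val (g c) = (G \o \val) c.
  by apply: submod_corestrict => c; apply: Gz; exact: (submod_typeP c).
apply: (@submod_quot_iso _ _ _ _ _ f g) => [c cb|c cb|c|c] /=.
- by rewrite fE; exact: Fb.
- by rewrite gE; exact: Gb.
- by rewrite gE /= fE; apply: GF; exact: (submod_typeP c).
- by rewrite fE /= gE; apply: FG; exact: (submod_typeP c).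
Qed.

Section Precomposition.
Variables (K : fieldType) (A : algType K) (M M' N : rmodType A).
Variable f : {linear M -> M'}.

Definition precomp (c : homr M' N) : homr M N :=
  GRing.Linear.clone _ _ _ _ (homr_fun c \o f) _.

Lemma precompE c x : precomp c x = c (f x). Proof. by []. Qed.

Fact precomp_linear : linear precomp.
Proof. by move=> a b c; apply/homrP. Qed.
HB.instance Definition _ :=
  GRing.isLinear.Build K (homr M' N) (homr M N) *:%R precomp precomp_linear.

End Precomposition.

Section ChainMapsAndCochains.
Variables (K : fieldType) (A : algType K) (N N' M : rmodType A).
Variables (P : proj_resolution N) (Q : proj_resolution N').

Lemma cocycle_precomp (f : graded_map P Q) n (c : homr (res_obj Q n) M) :
  chain_map f -> cocycle c -> cocycle (precomp (f n) c).
Proof. by move=> fd cz x; rewrite !precompE -fd cz. Qed.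

Lemma coboundary_precomp (f : graded_map P Q) n (c : homr (res_obj Q n) M) :
  chain_map f -> coboundary c -> coboundary (precomp (f n) c).
Proof.
case: n c => [|n] c fd /=; first by move->; rewrite linear0.
by move=> [h hE]; exists (precomp (f n) h) => x; rewrite !precompE hE fd.
Qed.

(** If f = d h + h d then c f = c d h + c h d, and c d = 0 as c is a cocycle. *)
Lemma coboundary_null_homotopic (f : graded_map P Q) n
    (c : homr (res_obj Q n) M) :
    chain_map f -> (forall x, res_aug Q (f 0 x) = 0) ->
  cocycle c -> coboundary (precomp (f n) c).
Proof.
move=> fd f0; have [h [h0 hS]] := chain_map_null_homotopic fd f0.
case: n c => [|n] c cz; first by apply/homrP => x; rewrite precompE h0 cz.
exists (precomp (h n) c) => x.
by rewrite !precompE hS linearD cz add0r.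
Qed.

End ChainMapsAndCochains.

(** An endomorphism of P over the identity of N differs from the identity by a
    null-homotopic map. *)
Lemma coboundary_chain_endo (K : fieldType) (A : algType K) (N M : rmodType A)
    (P : proj_resolution N) (e : graded_map P P) n (c : homr (res_obj P n) M) :
    chain_map e -> (forall x, res_aug P (e 0 x) = res_aug P x) ->
  cocycle c -> coboundary (precomp (e n) c - c).
Proof.
move=> ed ea cz.
have r_linear m : linear (fun x => e m x - x).
  by move=> k x y; rewrite linearP /= opprD addrACA -scalerBr.
pose r : graded_map P P := fun m => linear_of (r_linear m).
have -> : precomp (e n) c - c = precomp (r n) c.
  by apply/homrP => x; rewrite precompE /= linearB.
apply: coboundary_null_homotopic cz => [m x|x] /=.
  by rewrite linearB ed.
by rewrite linearB /= ea subrr.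
Qed.

(** Lift an isomorphism and its inverse to chain maps: their composites are
    chain endomorphisms over the identities. *)
Lemma cohomology_resolution_iso (K : fieldType) (A : algType K)
    (N N' M : rmodType A) (P : proj_resolution N) (Q : proj_resolution N') n :
  lmod_iso N N' -> lmod_iso (cohomology P M n) (cohomology Q M n).
Proof.
case=> a [b ab ba].
have b_linear : linear b.
  by move=> k x y; apply: (can_inj ab); rewrite linearP !ba.
have [f [fd fa]] := chain_map_lift P Q a.
have [g [gd gb]] := chain_map_lift Q P (linear_of b_linear).
apply: (@cohomology_iso K A A N N' P Q M M n (precomp (g n)) (precomp (f n))).
- by move=> c; exact: cocycle_precomp.
- by move=> c; exact: cocycle_precomp.
- by move=> c; exact: coboundary_precomp.
- by move=> c; exact: coboundary_precomp.
- move=> c /=; pose e : graded_map P P := fun m =>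
    GRing.Linear.clone _ _ _ _ (g m \o f m) _.
  have -> : precomp (f n) (precomp (g n) c) = precomp (e n) c by apply/homrP.
  apply: (@coboundary_chain_endo _ _ _ _ P e) => [m x|x] /=.
    by rewrite gd fd.
  by rewrite gb /= fa ab.
- move=> c /=; pose e : graded_map Q Q := fun m =>
    GRing.Linear.clone _ _ _ _ (f m \o g m) _.
  have -> : precomp (g n) (precomp (f n) c) = precomp (e n) c by apply/homrP.
  apply: (@coboundary_chain_endo _ _ _ _ Q e) => [m x|x] /=.
    by rewrite fd gd.
  by rewrite fa gb /= ba.
Qed.

(** * The adjunction between tensor product and Hom *)

Section TensorHom.
Variables (K : fieldType) (A B : algType K) (W : bimodType A B).

Section Adjunction.
Variables (M : rmodType A) (U : rmodType B).

(** Pure tensors typed in the right B-module, so that the operations on both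
    sides of the equations below come from one and the same structure. *)
Definition rtens (m : M) (w : W) : tensor_rmod M W := tens m (w : left_mod W).

Lemma rtens_ind (P : tensor_rmod M W -> Prop) :
    (forall m w, P (rtens m w)) -> (forall x y, P x -> P y -> P (x + y)) ->
  forall x, P x.
Proof. exact: (@tensor_ind A M (left_mod W) P). Qed.

Lemma rtensDl m m' w : rtens (m + m') w = rtens m w + rtens m' w.
Proof. exact: tensDl. Qed.

Lemma rtensDr m w w' : rtens m (w + w') = rtens m w + rtens m w'.
Proof. exact: tensDr. Qed.

Lemma rtens0l w : rtens 0 w = 0.
Proof. by apply: (addrI (rtens 0 w)); rewrite -rtensDl !addr0. Qed.

Lemma rtensZl (a : A) m w : rtens ((a : A^c) *: m) w = rtens m (lact a w).
Proof. exact: tensZ. Qed.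

Lemma rtensZr (b : B^c) m w : rtens m (b *: w) = b *: rtens m w.
Proof. exact: esym (rtensor_actE b m w). Qed.

Lemma rtens_linear (g : tensor_rmod M W -> U) :
    (forall u v, g (u + v) = g u + g v) ->
    (forall (b : B^c) m w, g (rtens m (b *: w)) = b *: g (rtens m w)) ->
  linear g.
Proof.
move=> gD gZ b u v; rewrite gD; congr (_ + _).
elim/rtens_ind: u => [m w|u u' hu hu']; first by rewrite -rtensZr.
have -> : b *: (u + u') = b *: u + b *: u' by exact: scalerDr.
by rewrite !gD scalerDr; congr (_ + _); [exact: hu|exact: hu'].
Qed.

Lemma rtens_ext (c d : {linear tensor_rmod M W -> U}) :
  (forall m w, c (rtens m w) = d (rtens m w)) -> c =1 d.
Proof.
move=> cd; elim/rtens_ind => [//|u v hu hv].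
by rewrite !linearD hu hv.
Qed.

Fact curry_fun_linear (c : homr (tensor_rmod M W) U) (m : M) :
  linear (fun w : W => c (rtens m w)).
Proof. by move=> b v w; rewrite rtensDr rtensZr linearP. Qed.

Definition curry_fun c (m : M) : hom_rmod W U :=
  linear_of (curry_fun_linear c m).

Fact curry_linear c : linear (curry_fun c).
Proof.
by move=> a m m'; apply/homrP => w /=; rewrite rtensDl rtensZl linearD.
Qed.

Definition curry c : homr M (hom_rmod W U) := linear_of (curry_linear c).

Lemma curryE c m w : (curry c m : homr W U) w = c (rtens m w).
Proof. by []. Qed.

Section Uncurry.
Variable f : homr M (hom_rmod W U).

(** U is seen as a module over the integers because tensor products are
    quotients of free abelian groups. *)
Let lift_gen : {linear {malg int[(M * left_mod W)%type]} -> zmodule U} :=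
  mlift (fun p : M * left_mod W => (f p.1 : homr W U) p.2 : zmodule U).

Let lift_genU m (w : left_mod W) : lift_gen << (m, w) >> = (f m : homr W U) w.
Proof. exact: mliftU. Qed.

Let lift_gen_rel x : tensor_rel x -> lift_gen x = 0.
Proof.
elim=> [|a y z _ y0 _ z0|m m' w|m w w'|m a w].
- exact: linear0.
- by rewrite linearP y0 z0 scaler0 addr0.
- by rewrite 2!linearB !lift_genU linearD /= addrAC addrK subrr.
- by rewrite 2!linearB !lift_genU linearD /= addrAC addrK subrr.
- by rewrite !linearB !lift_genU linearZ_LR /= subrr.
Qed.

Let lift_gen_eq x y :
  submod_pi (tensor_relators M (left_mod W)) x = submod_pi _ y ->
  lift_gen x = lift_gen y.
Proof.
move/submod_piP => xy; apply/eqP; rewrite -subr_eq0 -linearB.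
exact/eqP/lift_gen_rel.
Qed.

Definition uncurry_fun (u : tensor_rmod M W) : U := lift_gen (submod_rep u).

Fact uncurry_funE m w : uncurry_fun (rtens m w) = (f m : homr W U) w.
Proof. by rewrite -lift_genU; apply: lift_gen_eq; rewrite submod_repK. Qed.

Fact uncurry_funD u v : uncurry_fun (u + v) = uncurry_fun u + uncurry_fun v.
Proof.
rewrite -linearD; apply: lift_gen_eq.
by rewrite submod_piD !submod_repK.
Qed.

Fact uncurry_linear : linear uncurry_fun.
Proof.
apply: rtens_linear => [|b m w]; first exact: uncurry_funD.
by rewrite !uncurry_funE linearZ.
Qed.

Definition uncurry : homr (tensor_rmod M W) U := linear_of uncurry_linear.

End Uncurry.

End Adjunction.
End TensorHom.

(** * Tensoring a projective resolution *)

Section TensorExactness.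
Variables (K : fieldType) (A B : algType K) (W : bimodType A B).

Section Map.
Variables (M M' : rmodType A) (f : {linear M -> M'}).

Definition tensorW_fun (u : tensor_rmod M W) : tensor_rmod M' W :=
  tensor_map f idfun u.

Fact tensorW_funE m w : tensorW_fun (rtens m w) = rtens (f m) w.
Proof. exact: tensor_mapE. Qed.

Fact tensorW_linear : linear tensorW_fun.
Proof.
apply: rtens_linear => [u v|b m w]; first exact: raddfD.
by rewrite !tensorW_funE rtensZr.
Qed.

Definition tensorW : {linear tensor_rmod M W -> tensor_rmod M' W} :=
  linear_of tensorW_linear.

Lemma tensorWE m w : tensorW (rtens m w) = rtens (f m) w.
Proof. exact: tensorW_funE. Qed.

Lemma tensorW_surj :
  (forall y, exists x, f x = y) -> forall v, exists u, tensorW u = v.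
Proof.
move=> f_surj; elim/rtens_ind => [m w|u v [x xu] [y yv]].
  by have [l <-] := f_surj m; exists (rtens l w); rewrite tensorWE.
by exists (x + y); rewrite linearD xu yv.
Qed.

End Map.

(** Let C be the cokernel of f. Exactness makes g factor through an injection
    C -> N, which stays injective after tensoring by flatness; so an element u
    killed by g (x) W is killed by M (x) W -> C (x) W. It remains to see that
    the kernel of this last map is the image of f (x) W, that is, that the
    projection q of M (x) W onto the cokernel Q of f (x) W factors through
    C (x) W: the map M -> Hom_B(W, Q) adjoint to q kills the range of f, hence
    factors through C, and the adjoint of the resulting map C -> Hom_B(W, Q) is
    the required factorization. *)
Lemma tensorW_exact (L M N : rmodType A) (f : {linear L -> M})
    (g : {linear M -> N}) :
    flat (left_mod W) -> (forall x, g x = 0 <-> exists y, f y = x) ->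
  forall u, tensorW g u = 0 <-> exists v, tensorW f v = u.
Proof.
move=> flatW exfg u; split; last first.
  move=> [v <-].
  apply: (rtens_ext (c := tensorW g \o tensorW f) (d := \0)) => l w /=.
  by rewrite !tensorW_funE (proj2 (exfg (f l))) ?rtens0l //; exists l.
pose pi : {linear M -> submod_quot (image_submod f)} := submod_pi _.
have [g' g'E] : exists g' : {linear submod_quot (image_submod f) -> N},
    forall x, g' (pi x) = g x.
  by apply: submod_quot_factor => x /exfg.
have g'_inj : injective g'.
  move=> x y; rewrite -[x]submod_repK -[y]submod_repK !g'E => gxy.
  by apply/submod_piP/exfg; rewrite linearB gxy subrr.
have g'pi v : tensorW g' (tensorW pi v) = tensorW g v.
  apply: (rtens_ext (c := tensorW g' \o tensorW pi)) => m w /=.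
  by rewrite !tensorW_funE g'E.
pose Q : rmodType B := submod_quot (image_submod (tensorW f)).
pose q : homr (tensor_rmod M W) Q :=
  (submod_pi (image_submod (tensorW f)) : {linear tensor_rmod M W -> Q}).
have [k kE] : exists k : {linear submod_quot (image_submod f) -> hom_rmod W Q},
    forall m, k (pi m) = curry q m.
  apply: submod_quot_factor => _ [l <-]; apply/homrP => w.
  apply/submod_pi_eq0; exists (rtens l w); exact: tensorWE.
have qE v : uncurry k (tensorW pi v) = q v.
  apply: (rtens_ext (c := uncurry k \o tensorW pi) (d := q)) => m w /=.
  by rewrite tensorW_funE uncurry_funE kE.
move=> gu0; have piu0 : tensorW pi u = 0.
  apply: (flatW _ _ g' g'_inj); apply: etrans (g'pi u) _.
  rewrite gu0; exact: esym (linear0 (tensorW g')).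
apply: (proj1 (submod_pi_eq0 (image_submod (tensorW f)) u)).
apply: etrans (esym (qE u)) _.
by rewrite piu0 linear0.
Qed.

(** By adjunction, lifting P (x) W -> N along a surjection p : M -> N amounts to
    lifting P -> Hom_B(W, N) along composition with p, which is a surjection
    Hom_B(W, M) -> Hom_B(W, N) because W is projective. *)
Lemma tensorW_projective (P : rmodType A) :
  projective (W : rmodType B) -> projective P -> projective (tensor_rmod P W).
Proof.
move=> projW projP M N p c p_surj.
pose post (h : hom_rmod W M) : hom_rmod W N :=
  GRing.Linear.clone _ _ _ _ (p \o homr_fun h) _.
have post_linear : linear post.
  by move=> a h h'; apply/homrP => w /=; rewrite linearD.
have [k kE] : exists k : {linear P -> hom_rmod W M},
    forall x, linear_of post_linear (k x) = curry c x.
  apply: (projP _ _ (linear_of post_linear) (curry c)) => h.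
  have [h' h'E] := projW _ _ p h p_surj.
  by exists h'; apply/homrP.
exists (uncurry k); apply: (rtens_ext (c := p \o uncurry k)) => x w.
by rewrite /= uncurry_funE -curryE -kE.
Qed.

Hypotheses (W_projective : projective (W : rmodType B))
  (W_flat : flat (left_mod W)).

Definition tensor_resolution (N : rmodType A) (P : proj_resolution N) :
    proj_resolution (tensor_rmod N W) :=
  @ProjResolution K B (tensor_rmod N W) (fun n => tensor_rmod (res_obj P n) W)
    (fun n => tensorW (res_d P n)) (tensorW (res_aug P))
    (fun n => tensorW_projective W_projective (@res_proj _ _ _ P n))
    (tensorW_surj (@res_aug_surj _ _ _ P))
    (tensorW_exact W_flat (@res_exact0 _ _ _ P))
    (fun n => tensorW_exact W_flat (@res_exactS _ _ _ P n)).

End TensorExactness.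

(** * The isomorphism of Ext groups *)

Section AdjunctionIso.
Variables (K : fieldType) (A B : algType K) (W : bimodType A B).

Section Linear.
Variables (M : rmodType A) (U : rmodType B).

Lemma curryK : cancel (@curry K A B W M U) (@uncurry K A B W M U).
Proof.
move=> c; apply/homrP; apply: rtens_ext => m w.
by rewrite [LHS]uncurry_funE.
Qed.

Lemma uncurryK : cancel (@uncurry K A B W M U) (@curry K A B W M U).
Proof.
move=> f; apply/homrP => m; apply/homrP => w.
by rewrite [LHS]uncurry_funE.
Qed.

(** On the left K acts on U through B, on the right it acts on W through A; the
    two agree because K acts in the same way on both sides of W. *)
Fact curry_is_linear : linear (@curry K A B W M U).
Proof.
move=> k c d; apply/homrP => m; apply/homrP => w.
by rewrite /= lact_alg rtensZr linearZ.
Qed.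

Fact uncurry_is_linear : linear (@uncurry K A B W M U).
Proof.
move=> k f g; apply: (can_inj curryK).
by rewrite curry_is_linear !uncurryK.
Qed.

HB.instance Definition _ :=
  GRing.isLinear.Build K _ _ *:%R _ curry_is_linear.
HB.instance Definition _ :=
  GRing.isLinear.Build K _ _ *:%R _ uncurry_is_linear.

End Linear.

Hypotheses (W_projective : projective (W : rmodType B))
  (W_flat : flat (left_mod W)).
Variables (U : rmodType B) (N : rmodType A) (P : proj_resolution N).

Lemma cohomology_tensor_hom_iso n :
  lmod_iso (cohomology P (hom_rmod W U) n)
    (cohomology (tensor_resolution W_projective W_flat P) U n).
Proof.
apply: (@cohomology_iso K A B N (tensor_rmod N W) P
  (tensor_resolution W_projective W_flat P) (hom_rmod W U) U n
  (@uncurry K A B W (res_obj P n) U) (@curry K A B W (res_obj P n) U)).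
- move=> c cz; apply: (rtens_ext (c := uncurry c \o tensorW W (res_d P n))
    (d := \0)) => m w.
  by rewrite /= tensorW_funE uncurry_funE cz.
- move=> c cz x; apply/homrP => w.
  by rewrite [LHS]curryE -tensorWE cz.
- case: n => [|n] c /=; first by move->; exact: linear0.
  move=> [h hE]; exists (uncurry h).
  apply: (rtens_ext (c := uncurry c)
    (d := uncurry h \o tensorW W (res_d P n))) => m w.
  by rewrite /= tensorW_funE !uncurry_funE hE.
- case: n => [|n] c /=; first by move->; exact: linear0.
  move=> [h hE]; exists (curry h) => x; apply/homrP => w.
  by rewrite [LHS]curryE hE /= tensorW_funE.
- move=> c _; rewrite [X in X - _]uncurryK subrr.
  by case: n {c} => [|n] //; exists 0.
- move=> c _; rewrite [X in X - _]curryK subrr.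
  by case: n {c} => [|n] //; exists 0.
Qed.

End AdjunctionIso.

Lemma lmod_iso_trans (R : pzRingType) (V V' V'' : lmodType R) :
  lmod_iso V V' -> lmod_iso V' V'' -> lmod_iso V V''.
Proof.
move=> [f f_bij] [g g_bij].
exists (GRing.Linear.clone _ _ _ _ (g \o f) _).
exact: bij_comp g_bij f_bij.
Qed.

Theorem theorem3p2 (K : fieldType) (G H : groupType)
    (W : bimodType (par_alg K G) (group_alg K H))
    (W_projective : projective (W : rmodType (group_alg K H)))
    (W_flat : flat (left_mod W))
    (BW_trivial : lmod_iso (tensor_rmod (par_B K G) W) (triv_mod K H))
    (U : rmodType (group_alg K H)) (i : nat) :
  lmod_iso (Hpar i (hom_rmod W U)) (Hgroup i U).
Proof.
apply: lmod_iso_trans (cohomology_tensor_hom_iso W_projective W_flat U _ i) _.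
exact: cohomology_resolution_iso BW_trivial.
Qed.
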